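(* A closure space $A$ is polarized if and only if the truncated tensor product $\check A\otimes\check A$ is a quantale with the multiplication $R\odot S=\overline{R\cdot S}$.
   Context: A closure space $A$ is a set $\mathcal{U}A$ with a collection $\mathcal{C}A$ of subsets (''closed sets'') closed under arbitrary intersections (including $\bigcap\emptyset=\mathcal{U}A$). $\overline{X}$ denotes the least closed set containing $X$, $\overline{x}=\overline{\{x\}}$, and $\bot_A=\overline{\emptyset}$ is the least closed set. $A$ is polarized if for each $x\in\mathcal{U}A$ the polar $x^{\perp}=\{y\in\mathcal{U}A:\overline{x}\cap\overline{y}=\overline{\emptyset}\}$ is closed. $\check A$ is the subspace of $A$ on $\mathcal{U}A\setminus\bot_A$, whose closed sets are the sets $C\setminus\bot_A$ with $C\in\mathcal{C}A$. For closure spaces $A,B$, the tensor product $A\otimes B$ is the set, ordered by inclusion, of all tensors, i.e. subsets $T\subseteq\mathcal{U}A\times\mathcal{U}B$ such that for each $x\in\mathcal{U}A$, $\{y:(x,y)\in T\}$ is closed in $B$ and for each $y\in\mathcal{U}B$, $\{x:(x,y)\in T\}$ is closed in $A$. It is a closure system, hence a complete lattice. For $R,S\in\check A\otimes\check A$, $R\cdot S=\{(a,c):\exists b\ (a,b)\in R,\ (b,c)\in S\}$ and $\overline{R\cdot S}$ is the least member of $\check A\otimes\check A$ containing $R\cdot S$. A quantale is a complete lattice with an associative multiplication distributing over arbitrary joins on both sides. *)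

(* Defs.v *)
From HB Require Import structures.
From mathcomp Require Import all_boot all_order.
From mathcomp Require Import boolp classical_sets.

Set Implicit Arguments.
Unset Strict Implicit.
Unset Printing Implicit Defensive.

Local Open Scope classical_set_scope.

(* The intersection of the empty family is [setT], so the whole carrier is
   always closed. *)
Record closureSpace := ClosureSpace {
  carrier :> Type;
  is_closed : set (set carrier);
  closed_bigcap : forall F : set (set carrier),
    F `<=` is_closed -> is_closed (\bigcap_(C in F) C)
}.

Arguments is_closed {c} _.

Definition closure (A : closureSpace) (X : set A) : set A :=
  smallest is_closed X.

Lemma closure_closed (A : closureSpace) (X : set A) : is_closed (closure X).
Proof. by apply: closed_bigcap => C []. Qed.

Definition bot (A : closureSpace) : set A := closure set0.

Arguments bot : clear implicits.

Definition polar (A : closureSpace) (x : A) : set A :=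
  [set y | closure [set x] `&` closure [set y] = closure set0].

Definition polarized (A : closureSpace) : Prop :=
  forall x : A, is_closed (polar x).

Section Subspace.
Variables (A : closureSpace) (S : set A).

Definition subspace_closed : set (set {x : A | S x}) :=
  [set D | exists2 C : set A, is_closed C & D = sval @^-1` C].

Lemma subspace_closed_bigcap (F : set (set {x : A | S x})) :
  F `<=` subspace_closed -> subspace_closed (\bigcap_(D in F) D).
Proof.
move=> Fc.
exists (\bigcap_(C in [set C | is_closed C /\ F (sval @^-1` C)]) C).
  by apply: closed_bigcap => C [].
apply/seteqP; split => x /= xF.
  by move=> C /= [_ FC]; exact: (xF _ FC).
move=> D FD; have [C cC DE] := Fc _ FD.
by rewrite DE; apply: xF; split => //; rewrite -DE.
Qed.

Definition subspace : closureSpace := ClosureSpace subspace_closed_bigcap.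

End Subspace.

Definition check (A : closureSpace) : closureSpace := subspace (~` bot A).

Section ClosedSets.
Variable A : closureSpace.

Record closedSet := ClosedSet {
  closed_val :> set A;
  _ : closed_val \in is_closed
}.

HB.instance Definition _ := [isSub for closed_val].
HB.instance Definition _ := [Choice of closedSet by <:].
HB.instance Definition _ := [SubChoice_isSubPOrder of closedSet by <: with set_display].

Lemma le_closedSetE (C D : closedSet) :
  (C <= D)%O = (closed_val C `<=` closed_val D) :> Prop.
Proof. exact: subsetEset. Qed.

Definition closureSet (X : set A) : closedSet :=
  ClosedSet (mem_set (closure_closed X)).

End ClosedSets.

Section Tensor.
Variables A B : closureSpace.

Definition is_tensor : set (set (A * B)) :=
  [set T | (forall x, is_closed (xsection T x)) /\
           (forall y, is_closed (ysection T y))].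

Lemma is_tensor_bigcap (F : set (set (A * B))) :
  F `<=` is_tensor -> is_tensor (\bigcap_(T in F) T).
Proof.
move=> Ft; split=> [x|y].
  rewrite (_ : xsection _ _ = \bigcap_(C in [set xsection T x | T in F]) C).
    by apply: closed_bigcap => _ [T /Ft[cT _] <-].
  rewrite bigcap_image xsectionE.
  by apply/seteqP; split=> z H T FT; move: (H T FT); rewrite xsectionE.
rewrite (_ : ysection _ _ = \bigcap_(C in [set ysection T y | T in F]) C).
  by apply: closed_bigcap => _ [T /Ft[_ cT] <-].
rewrite bigcap_image ysectionE.
by apply/seteqP; split=> z H T FT; move: (H T FT); rewrite ysectionE.
Qed.

Definition tensorSpace : closureSpace := ClosureSpace is_tensor_bigcap.

End Tensor.

Notation "A ⊗ B" := (closedSet (tensorSpace A B))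
  (at level 40, left associativity) : type_scope.

Definition rel_mul (T : Type) (R S : set (T * T)) : set (T * T) :=
  [set ac | exists b, R (ac.1, b) /\ S (b, ac.2)].

Definition tensor_mul (A : closureSpace) (R S : A ⊗ A) : A ⊗ A :=
  closureSet (rel_mul R S : set (tensorSpace A A)).

Definition complete_lattice {d} (T : porderType d) : Prop :=
  forall X : set T, supremums X !=set0 /\ infimums X !=set0.

Record is_quantale {d} {T : porderType d} (mul : T -> T -> T) : Prop := {
  quantale_complete : complete_lattice T;
  quantale_mulA : associative mul;
  quantale_mul_supr : forall (a : T) (X : set T) (s : T),
    supremums X s -> supremums [set mul a x | x in X] (mul a s);
  quantale_mul_supl : forall (a : T) (X : set T) (s : T),
    supremums X s -> supremums [set mul x a | x in X] (mul s a)
}.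

(* Main.v *)
Require Import Defs.
From mathcomp Require Import all_boot all_order.
From mathcomp Require Import boolp classical_sets.
(* Importing again makes [closure] the operator of a closure space instead of
   the graph-theoretic abbreviation of [fingraph]. *)
Import Defs.

(** Both directions reduce to a closure space [B] whose empty set is closed:
    deleting the least closed set from [A] makes the empty set closed, and it
    changes polars only by that deleted set, so [A] and [check A] are
    polarized together ([polarized_check]).

    Suppose [B] is polarized.  The polar of an arbitrary closed set is then
    closed, being the intersection of the polars of its points.  The quantale
    laws come down to the inclusion of [closure X . S] in [closure (X . S)]
    for a tensor [S] and a relation [X], and to its mirror image.  Given a
    tensor [T] containing [X . S], the natural tensor to put around [X] would
    be the residual of [T] by [S], the set of all [(a, b)] such that [S (b, c)]
    implies [T (a, c)] for every [c].  It need not be a tensor.  Its hereditary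
    part, where the condition is imposed on every point of the closure of [b],
    is one: for fixed [a] it is the intersection, over the [c] outside
    [T (a, _)], of the polars of the closed sets [S (_, c)].  It contains [X]
    as soon as [X] is stable under replacing [b] by a point of its closure;
    tensors, their unions and their products all have this stability, which is
    what associativity and distributivity ask for.

    Conversely, let [y] be in the closure of the polar of [x] and [z] in the
    closures of both [x] and [y].  Rectangles with closed sides are tensors
    because the empty set is closed.  For [u] in the polar of [x], the
    rectangle on [x] and [u] multiplied by the rectangle on [x] and [x] gives
    the empty tensor, so by distributivity the join of the former multiplied by
    the latter is empty too.  But that product contains [(x, x)], through
    [z]. *)

Set Implicit Arguments.
Unset Strict Implicit.
Unset Printing Implicit Defensive.

Local Open Scope classical_set_scope.

(** * Closure operators *)

Section ClosureTheory.
Variable A : closureSpace.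
Implicit Types (X Y C : set A) (x y : A).

Lemma closed_bigcapF (I : Type) (D : set I) (F : I -> set A) :
  (forall i, D i -> is_closed (F i)) -> is_closed (\bigcap_(i in D) F i).
Proof.
move=> Fc; rewrite -(bigcap_image D F (fun C => C)).
by apply: closed_bigcap => _ [i /Fc ? <-].
Qed.

Lemma closedT : is_closed [set: A].
Proof.
rewrite (_ : setT = \bigcap_(C in (set0 : set (set A))) C).
  exact: closed_bigcap.
by rewrite bigcap_set0.
Qed.

Lemma sub_closure X : X `<=` closure X.
Proof. by move=> x Xx C [_]; apply. Qed.

Lemma closure_min X C : is_closed C -> X `<=` C -> closure X `<=` C.
Proof. by move=> cC XC x; apply. Qed.

Lemma closureS X Y : X `<=` Y -> closure X `<=` closure Y.
Proof.
move=> XY; apply: closure_min; first exact: closure_closed.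
exact: subset_trans (@sub_closure Y).
Qed.

Lemma mem_closure1 x : closure [set x] x.
Proof. exact: sub_closure. Qed.

Lemma closure1_sub C x : is_closed C -> C x -> closure [set x] `<=` C.
Proof. by move=> cC Cx; apply: closure_min => // _ ->. Qed.

Lemma bot_sub_closure X : bot A `<=` closure X.
Proof. exact: closureS. Qed.

Lemma is_closed_closedSet (C : closedSet A) : is_closed C.
Proof. by case: C => C /= /set_mem. Qed.

Lemma closedSet_supremumsP (F : set (closedSet A)) (s : closedSet A) :
  supremums F s <-> closed_val s = closure (\bigcup_(C in F) closed_val C).
Proof.
split=> [[ubs lbs]|sE].
  apply/seteqP; split.
    suff : (s <= closureSet (\bigcup_(C in F) closed_val C))%O.
      by rewrite le_closedSetE.
    apply: lbs => C FC; rewrite le_closedSetE /=.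
    by apply: subset_trans (@sub_closure _); exact: bigcup_sup.
  apply: closure_min; first exact: is_closed_closedSet.
  by apply: bigcup_sub => C /ubs; rewrite le_closedSetE.
split=> [C FC|D ubD]; rewrite le_closedSetE sE.
  by apply: subset_trans (@sub_closure _); exact: bigcup_sup.
apply: closure_min; first exact: is_closed_closedSet.
by apply: bigcup_sub => C /ubD; rewrite le_closedSetE.
Qed.

Lemma closedSet_complete : complete_lattice (closedSet A).
Proof.
move=> F; split.
  exists (closureSet (\bigcup_(C in F) closed_val C)).
  exact/closedSet_supremumsP.
have cI : is_closed (\bigcap_(C in F) closed_val C).
  by apply: closed_bigcapF => C _; exact: is_closed_closedSet.
exists (ClosedSet (mem_set cI)); split=> [C FC|D lbD]; rewrite le_closedSetE /=.
  exact: bigcap_inf.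
by apply: sub_bigcap => C /lbD; rewrite le_closedSetE.
Qed.

End ClosureTheory.

(** * Deleting the least closed set *)

Section Check.
Variable A : closureSpace.

Lemma check_closed0 : is_closed (set0 : set (check A)).
Proof.
exists (bot A); first exact: closure_closed.
by apply/seteqP; split=> // -[x /= nx].
Qed.

Lemma closure_check1 (x : check A) :
  closure [set x] = sval @^-1` closure [set sval x].
Proof.
apply/seteqP; split.
  apply: closure1_sub; last exact: mem_closure1.
  by exists (closure [set sval x]) => //; exact: closure_closed.
have [C cC CE] := closure_closed [set x].
rewrite CE => y /=; apply: closure1_sub => //.
by have := @mem_closure1 _ x; rewrite CE.
Qed.

Lemma closure_check0 : closure (set0 : set (check A)) = set0.
Proof. by rewrite -subset0; apply: closure_min => //; exact: check_closed0. Qed.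

Lemma polar_check (x : check A) : polar x = sval @^-1` polar (sval x).
Proof.
apply/seteqP; split=> y; rewrite /polar /= closure_check0 !closure_check1 => xy.
  apply/seteqP; split=> z; last by move=> ?; split; exact: bot_sub_closure.
  move=> [zx zy]; apply: contrapT => nz.
  by have : set0 (exist _ z nz : check A) by rewrite -xy.
rewrite -subset0 => z [zx zy].
by apply: (svalP z); move: (conj zx zy : (_ `&` _) (sval z)); rewrite xy.
Qed.

Lemma bot_sub_polar (x : A) : bot A `<=` polar x.
Proof.
move=> y by_; apply/seteqP; split=> z; last first.
  by move=> ?; split; exact: bot_sub_closure.
by case=> _; apply: (closure1_sub _ by_); exact: closure_closed.
Qed.

Lemma polarized_check : polarized A <-> polarized (check A).
Proof.
split=> pA x; first by rewrite polar_check; exists (polar (sval x)).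
have [bx|nbx] := pselect (bot A x).
  rewrite (_ : polar x = setT); first exact: closedT.
  apply/seteqP; split=> // y _; rewrite /polar /= setIC.
  exact: bot_sub_polar bx.
have [C cC] := pA (exist _ x nbx); rewrite polar_check /= => CE.
(* A closed set contains the least one, so [polar x] and [C] can only differ
   outside [bot A], where they are both traced by the polar in [check A]. *)
rewrite (_ : polar x = C) //; apply/seteqP.
have {}CE y : ~ bot A y -> polar x y = C y.
  by move=> nby; have /(congr1 (fun D => D (exist _ y nby))) := CE.
have bC : bot A `<=` C by exact: closure_min.
split=> y; have [yb|nyb] := pselect (bot A y).
- by move=> _; exact: bC.
- by rewrite CE.
- by move=> _; exact: bot_sub_polar.
- by rewrite CE.
Qed.

End Check.

(** * Products of tensors over a polarized space *)

Section Tensor.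
Variable B : closureSpace.
Hypothesis closed0 : is_closed (set0 : set B).
Implicit Types (X Y R S T : set (B * B)) (C D : set B).

Let closure0 : closure (set0 : set B) = set0.
Proof. by rewrite -subset0; exact: closure_min. Qed.

Lemma tensor_closedr T a : is_tensor T -> is_closed [set b | T (a, b)].
Proof. by case=> /(_ a); rewrite xsectionE. Qed.

Lemma tensor_closedl T b : is_tensor T -> is_closed [set a | T (a, b)].
Proof. by case=> _ /(_ b); rewrite ysectionE. Qed.

Lemma is_tensorP T :
  (forall a, is_closed [set b | T (a, b)]) ->
  (forall b, is_closed [set a | T (a, b)]) -> is_tensor T.
Proof.
by move=> Tr Tl; split=> z; rewrite ?xsectionE ?ysectionE;
  [exact: Tr|exact: Tl].
Qed.

Definition tensor_closure X : set (B * B) := @closure (tensorSpace B B) X.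

Lemma tensor_closure_tensor X : is_tensor (tensor_closure X).
Proof. exact: (@closure_closed (tensorSpace B B)). Qed.

Lemma is_tensor_val (R : B ⊗ B) : is_tensor R.
Proof. exact: (@is_closed_closedSet (tensorSpace B B)). Qed.

Lemma sub_tensor_closure X : X `<=` tensor_closure X.
Proof. exact: (@sub_closure (tensorSpace B B)). Qed.

Lemma tensor_closure_min X T :
  is_tensor T -> X `<=` T -> tensor_closure X `<=` T.
Proof. exact: (@closure_min (tensorSpace B B)). Qed.

Lemma tensor_closureS X Y : X `<=` Y -> tensor_closure X `<=` tensor_closure Y.
Proof. exact: (@closureS (tensorSpace B B)). Qed.

Lemma rel_mulS X X' Y Y' :
  X `<=` X' -> Y `<=` Y' -> rel_mul X Y `<=` rel_mul X' Y'.
Proof. by move=> XX' YY' ac [b [/XX' ? /YY' ?]]; exists b. Qed.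

Lemma rel_mulA X Y S : rel_mul X (rel_mul Y S) = rel_mul (rel_mul X Y) S.
Proof.
apply/seteqP; split=> -[a d] /=.
  by move=> [b [Xab [c [Ybc Scd]]]]; exists c; split=> //; exists b.
by move=> [c [[b [Xab Ybc]] Scd]]; exists b; split=> //; exists c.
Qed.

Definition hereditaryr X :=
  forall a b b', X (a, b) -> closure [set b] b' -> X (a, b').

Definition hereditaryl X :=
  forall a a' b, X (a, b) -> closure [set a] a' -> X (a', b).

Lemma tensor_hereditaryr T : is_tensor T -> hereditaryr T.
Proof.
move=> tT a b b' Tab; apply: (closure1_sub (C := [set b | T (a, b)])) => //.
exact: tensor_closedr.
Qed.

Lemma tensor_hereditaryl T : is_tensor T -> hereditaryl T.
Proof.
move=> tT a a' b Tab; apply: (closure1_sub (C := [set a | T (a, b)])) => //.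
exact: tensor_closedl.
Qed.

Lemma rel_mul_hereditaryr R S : hereditaryr S -> hereditaryr (rel_mul R S).
Proof.
by move=> hS a b b' [c /= [Rac Scb]] bb'; exists c; split=> //; exact: hS bb'.
Qed.

Lemma rel_mul_hereditaryl R S : hereditaryl R -> hereditaryl (rel_mul R S).
Proof.
by move=> hR a a' b [c /= [Rac Scb]] aa'; exists c; split=> //; exact: hR aa'.
Qed.

Section Polarized.
Hypothesis polB : polarized B.

(** The polar of a closed set is the intersection of the polars of its points,
    since a closed set contains the closure of each of its points. *)
Lemma closed_polar_set C :
  is_closed C -> is_closed [set b | closure [set b] `&` C `<=` set0].
Proof.
move=> cC.
rewrite (_ : [set b | _] = \bigcap_(x in C) polar x).
  by apply: closed_bigcapF => x _; exact: polB.
apply/seteqP; split=> b /= bC.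
  move=> x Cx; rewrite /polar /= closure0; rewrite -subset0 => z [zx zb].
  by apply: (bC z); split=> //; exact: closure1_sub zx.
move=> x [xb /bC xpb]; rewrite -closure0 -[closure set0]xpb.
by split=> //; exact: (@mem_closure1 B).
Qed.

(** Hereditarity replaces [is_tensor X] because the relations to which this is
    applied are unions and products of tensors.  The tensor [W] is the
    hereditary part of the residual of [closure (X . S)] by [S]. *)
Lemma rel_mul_closurel X S : is_tensor S -> hereditaryr X ->
  rel_mul (tensor_closure X) S `<=` tensor_closure (rel_mul X S).
Proof.
move=> tS hX; set T := tensor_closure (rel_mul _ _).
have tT : is_tensor T by exact: tensor_closure_tensor.
pose W := [set ab : B * B | forall b' c,
  closure [set ab.2] b' -> S (b', c) -> T (ab.1, c)].
suff XW : tensor_closure X `<=` W.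
  move=> [a c] [b [/XW Wab Sbc]].
  exact: (Wab b c (@mem_closure1 B b) Sbc).
apply: tensor_closure_min; last first.
  move=> [a b] Xab b' c /= bb' Sbc; apply: sub_tensor_closure.
  by exists b'; split=> //; exact: hX bb'.
apply: is_tensorP => [a|b].
  rewrite (_ : [set b | _] = \bigcap_(c in [set c | ~ T (a, c)])
      [set b | closure [set b] `&` [set b' | S (b', c)] `<=` set0]).
    apply: closed_bigcapF => c _; apply: closed_polar_set.
    exact: tensor_closedl.
  apply/seteqP; split=> b /= Wab.
    by move=> c nTac b' [bb' Sbc]; apply: nTac; exact: (Wab b' c).
  move=> b' c bb' Sbc; apply: contrapT => nTac.
  exact: (Wab c nTac b').
rewrite (_ : [set a | _] =
    \bigcap_(bc in [set bc | closure [set b] bc.1 /\ S bc])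
      [set a | T (a, bc.2)]).
  by apply: closed_bigcapF => bc _; exact: tensor_closedl.
apply/seteqP; split=> a /= Wab; first by move=> [b' c] []; exact: (Wab b' c).
by move=> b' c bb' Sbc; exact: (Wab (b', c) (conj bb' Sbc)).
Qed.

Lemma rel_mul_closurer R X : is_tensor R -> hereditaryl X ->
  rel_mul R (tensor_closure X) `<=` tensor_closure (rel_mul R X).
Proof.
move=> tR hX; set T := tensor_closure (rel_mul _ _).
have tT : is_tensor T by exact: tensor_closure_tensor.
pose W := [set bc : B * B | forall b' a,
  closure [set bc.1] b' -> R (a, b') -> T (a, bc.2)].
suff XW : tensor_closure X `<=` W.
  move=> [a c] [b [Rab /XW Wbc]].
  exact: (Wbc b a (@mem_closure1 B b) Rab).
apply: tensor_closure_min; last first.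
  move=> [b c] Xbc b' a /= bb' Rab; apply: sub_tensor_closure.
  by exists b'; split=> //; exact: hX bb'.
apply: is_tensorP => [b|c].
  rewrite (_ : [set c | _] =
      \bigcap_(ab in [set ab | closure [set b] ab.2 /\ R ab])
        [set c | T (ab.1, c)]).
    by apply: closed_bigcapF => ab _; exact: tensor_closedr.
  apply/seteqP; split=> c /= Wbc; first by move=> [a b'] []; exact: (Wbc b' a).
  by move=> b' a bb' Rab; exact: (Wbc (a, b') (conj bb' Rab)).
rewrite (_ : [set b | _] = \bigcap_(a in [set a | ~ T (a, c)])
    [set b | closure [set b] `&` [set b' | R (a, b')] `<=` set0]).
  by apply: closed_bigcapF => a _; apply: closed_polar_set;
    exact: tensor_closedr.
apply/seteqP; split=> b /= Wbc.
  by move=> a nTac b' [bb' Rab]; apply: nTac; exact: (Wbc b' a).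
move=> b' a bb' Rab; apply: contrapT => nTac.
exact: (Wbc a nTac b').
Qed.

Lemma tensor_mulA : associative (@tensor_mul B).
Proof.
move=> R S T; apply: val_inj; rewrite /= -!/(tensor_closure _).
have [tR tS tT] : [/\ is_tensor R, is_tensor S & is_tensor T].
  by split; exact: is_tensor_val.
(* Both sides are the closure of the triple product. *)
transitivity (tensor_closure (rel_mul R (rel_mul S T))).
  apply/seteqP; split; last first.
    by apply: tensor_closureS; apply: rel_mulS => //; exact: sub_tensor_closure.
  apply: tensor_closure_min; first exact: tensor_closure_tensor.
  apply: rel_mul_closurer => //.
  by apply: rel_mul_hereditaryl; exact: tensor_hereditaryl.
rewrite rel_mulA; apply/seteqP; split.
  by apply: tensor_closureS; apply: rel_mulS => //; exact: sub_tensor_closure.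
apply: tensor_closure_min; first exact: tensor_closure_tensor.
apply: rel_mul_closurel => //.
by apply: rel_mul_hereditaryr; exact: tensor_hereditaryr.
Qed.

Lemma tensor_mul_supr (R : B ⊗ B) (F : set (B ⊗ B)) (s : B ⊗ B) :
  supremums F s -> supremums [set tensor_mul R S | S in F] (tensor_mul R s).
Proof.
move=> /closedSet_supremumsP sE; apply/closedSet_supremumsP.
rewrite bigcup_image /= sE -!/(tensor_closure _); apply/seteqP; split.
  apply: tensor_closure_min; first exact: tensor_closure_tensor.
  apply: subset_trans (rel_mul_closurer _ _) _.
  - exact: is_tensor_val.
  - move=> b b' c [S FS Sbc] bb'; exists S => //.
    by apply: tensor_hereditaryl bb' => //; exact: is_tensor_val.
  - apply: tensor_closureS => -[a c] [b [Rab [S FS Sbc]]].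
    by exists S => //; apply: sub_tensor_closure; exists b.
apply: tensor_closure_min; first exact: tensor_closure_tensor.
apply: bigcup_sub => S FS; apply: tensor_closureS; apply: rel_mulS => //.
apply: subset_trans (@sub_tensor_closure _).
exact: (@bigcup_sup _ _ S).
Qed.

Lemma tensor_mul_supl (R : B ⊗ B) (F : set (B ⊗ B)) (s : B ⊗ B) :
  supremums F s -> supremums [set tensor_mul S R | S in F] (tensor_mul s R).
Proof.
move=> /closedSet_supremumsP sE; apply/closedSet_supremumsP.
rewrite bigcup_image /= sE -!/(tensor_closure _); apply/seteqP; split.
  apply: tensor_closure_min; first exact: tensor_closure_tensor.
  apply: subset_trans (rel_mul_closurel _ _) _.
  - exact: is_tensor_val.
  - move=> a b b' [S FS Sab] bb'; exists S => //.
    by apply: tensor_hereditaryr bb' => //; exact: is_tensor_val.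
  - apply: tensor_closureS => -[a c] [b [[S FS Sab] Rbc]].
    by exists S => //; apply: sub_tensor_closure; exists b.
apply: tensor_closure_min; first exact: tensor_closure_tensor.
apply: bigcup_sub => S FS; apply: tensor_closureS; apply: rel_mulS => //.
apply: subset_trans (@sub_tensor_closure _).
exact: (@bigcup_sup _ _ S).
Qed.

Lemma polarized_is_quantale : is_quantale (@tensor_mul B).
Proof.
split; first exact: closedSet_complete.
- exact: tensor_mulA.
- exact: tensor_mul_supr.
- exact: tensor_mul_supl.
Qed.

End Polarized.

(** * Polarity from distributivity *)

(** A section of a rectangle is one of its sides or the empty set. *)
Lemma rectangle_tensor C D : is_closed C -> is_closed D -> is_tensor (C `*` D).
Proof.
move=> cC cD; apply: is_tensorP => [a|b].
  have [Ca|nCa] := pselect (C a).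
    by rewrite (_ : [set b | _] = D) //; apply/seteqP; split=> b //= [].
  by rewrite (_ : [set b | _] = set0) //; apply/seteqP; split=> b //= [].
have [Db|nDb] := pselect (D b).
  by rewrite (_ : [set a | _] = C) //; apply/seteqP; split=> a //= [].
by rewrite (_ : [set a | _] = set0) //; apply/seteqP; split=> a //= [].
Qed.

Definition rectangle (x y : B) : B ⊗ B :=
  ClosedSet (mem_set (rectangle_tensor (closure_closed [set x])
                                       (closure_closed [set y]))
             : (_ : set (tensorSpace B B)) \in is_closed).

Lemma is_quantale_polarized : is_quantale (@tensor_mul B) -> polarized B.
Proof.
move=> [_ _ _ supl] x.
suff clp : closure (polar x) `<=` polar x.
  rewrite (_ : polar x = closure (polar x)); first exact: closure_closed.
  by apply/seteqP; split=> //; exact: sub_closure.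
move=> y py; rewrite /polar /= closure0; rewrite -subset0 => z [zx zy].
pose F : set (B ⊗ B) := [set rectangle x u | u in polar x].
pose s := closureSet (\bigcup_(R in F) (closed_val R : set (tensorSpace B B))).
have ts : is_tensor s := is_tensor_val s.
have : supremums F s by apply/closedSet_supremumsP.
move=> /(supl (rectangle x x)) /closedSet_supremumsP sE.
have sxz : closed_val s (x, z).
  apply: (tensor_hereditaryr ts) zy.
  apply: (closure_min (C := [set u | closed_val s (x, u)])) py.
    exact: tensor_closedr.
  move=> u pu; apply: sub_tensor_closure; exists (rectangle x u).
    by exists u.
  by split; exact: (@mem_closure1 B).
have : closed_val (tensor_mul s (rectangle x x)) (x, x).
  apply: sub_tensor_closure; exists z; split=> //=.
  by split=> //; exact: (@mem_closure1 B).
have t0 : is_tensor (set0 : set (B * B)) by exact: is_tensorP.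
rewrite sE; apply: (tensor_closure_min t0).
apply: bigcup_sub => _ [_ [u pu <-] <-]; apply: tensor_closure_min => //.
move=> [a c] [b [[_ /= ub] [/= xb _]]].
by have : (set0 : set B) b by rewrite -closure0 -[closure set0]pu.
Qed.

End Tensor.

Theorem theorem8p3 (A : closureSpace) :
  polarized A <-> is_quantale (@tensor_mul (check A)).
Proof.
have c0 := @check_closed0 A.
split=> [pA|qA].
  by apply: (polarized_is_quantale c0); apply/(polarized_check A).
by apply/(polarized_check A); exact: is_quantale_polarized.
Qed.
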